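(* Let $X$ be any nonempty set and let $k$ be a field. If $k$ is infinite, then every proper $T$-space of $k\langle X\rangle_0$ is contained in $Z$.
   Context: $k\langle X\rangle_0$ denotes the free (nonunitary) associative $k$-algebra on $X$. A $T$-space of an associative $k$-algebra $A$ is a $k$-linear subspace invariant under every $k$-algebra endomorphism of $A$; a $T$-ideal is a $T$-space that is also a two-sided ideal; $H^T$ denotes the smallest $T$-ideal of $A$ containing $H\subseteq A$. $Z$ denotes the following $T$-ideal of $k\langle X\rangle_0$: if $|X|>1$, $Z=\{xy\}^T$ where $x,y\in X$ are distinct; if $X=\{x\}$, $Z=\{x^2\}^T$. *)

(* Defs.v *)
From HB Require Import structures.
From mathcomp Require Import all_boot all_order all_algebra.
From mathcomp Require Import boolp classical_sets functions cardinality.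
From mathcomp Require Import finmap monalg.

Set Implicit Arguments.
Unset Strict Implicit.
Unset Printing Implicit Defensive.

Import GRing.Theory.
Local Open Scope classical_set_scope.
Local Open Scope ring_scope.

(* Associative algebras over a field, not assumed to have a unit: MathComp's
   [algType] always has one. *)
HB.mixin Record Lmodule_isNUAlgebra (k : fieldType) A of GRing.Lmodule k A := {
  numul : A -> A -> A;
  numulA : associative numul;
  numulDl : left_distributive numul +%R;
  numulDr : right_distributive numul +%R;
  scale_numull : forall (c : k) (a b : A), c *: numul a b = numul (c *: a) b;
  scale_numulr : forall (c : k) (a b : A), c *: numul a b = numul a (c *: b)
}.

#[short(type="nuAlgType")]
HB.structure Definition NUAlgebra (k : fieldType) :=
  { A of GRing.Lmodule k A & Lmodule_isNUAlgebra k A }.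

Declare Scope nualg_scope.
Delimit Scope nualg_scope with NU.
Notation "a * b" := (numul a b) : nualg_scope.

Section TSpaces.
Context {k : fieldType} {A : nuAlgType k}.

Definition nualg_endo (phi : A -> A) : Prop :=
  linear phi /\ {morph phi : a b / (a * b)%NU}.

Definition Tspace (S : set A) : Prop :=
  [/\ S 0,
      forall (c : k) (a b : A), S a -> S b -> S (c *: a + b)
    & forall phi : A -> A, nualg_endo phi -> forall a, S a -> S (phi a)].

Definition Tideal (I : set A) : Prop :=
  Tspace I /\ forall a b : A, I b -> I (a * b)%NU /\ I (b * a)%NU.

Definition Tideal_gen (H : set A) : set A := smallest Tideal H.

Lemma Tideal_gen_Tideal (H : set A) : Tideal (Tideal_gen H).
Proof.
split; first split.
- by move=> I [[[]]].
- move=> c a b Sa Sb I IH; case: (IH) => [[[_ IL _] _] _].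
  by apply: IL; [exact: Sa | exact: Sb].
- move=> phi ephi a Sa I IH; case: (IH) => [[[_ _ Iphi] _] _].
  by apply: Iphi => //; exact: Sa.
- by move=> a b Sb; split=> I IH; case: (IH) => [[_ /(_ a b (Sb I IH))[]]].
Qed.

End TSpaces.

(* {malg k[{fmonom X}]} is the free unitary algebra k<X> (finitely supported
   k-valued functions on the free monoid on X); the free nonunitary algebra is
   the span in it of the nonempty words, i.e., its elements with constant
   coefficient 0. Taking X : choiceType, as finitely supported functions
   require, is no restriction: any Y : Type is covered by {classic Y}. *)
Section FreeNUAlgebra.
Context (k : fieldType) (X : choiceType).

Definition no_constant : {pred {malg k[{fmonom X}]}} :=
  [pred f | mcoeff mone f == 0].

Fact no_constant_submod : submod_closed no_constant.
Proof.
split=> [|c f g]; rewrite !inE ?mcoeff0 // => /eqP f0 /eqP g0.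
by rewrite mcoeffD mcoeffZ f0 g0 mulr0 addr0.
Qed.

HB.instance Definition _ :=
  GRing.isSubmodClosed.Build k {malg k[{fmonom X}]} no_constant
    no_constant_submod.

Record free_nualg := FreeNUAlg {
  free_nualg_val :> {malg k[{fmonom X}]};
  _ : free_nualg_val \in no_constant
}.

HB.instance Definition _ := [isSub for free_nualg_val].
HB.instance Definition _ := [Choice of free_nualg by <:].
HB.instance Definition _ := [SubChoice_isSubLmodule of free_nualg by <:].

Fact no_constant_mul (f g : {malg k[{fmonom X}]}) :
  f \in no_constant -> f * g \in no_constant.
Proof.
rewrite !inE (mcoeff1g_is_multiplicative _ _).1 => /eqP ->.
by rewrite mul0r.
Qed.

Fact malg_scalerAr (c : k) (f g : {malg k[{fmonom X}]}) :
  c *: (f * g) = f * (c *: g).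
Proof.
rewrite scalerAl (malgMEw (msuppZ_le c f) (fsubset_refl _)).
rewrite (malgMEw (fsubset_refl _) (msuppZ_le c g)).
apply: eq_bigr => u _; apply: eq_bigr => v _.
by rewrite !mcoeffZ -mulrA mulrCA.
Qed.

Definition free_nualg_mul (f g : free_nualg) : free_nualg :=
  FreeNUAlg (no_constant_mul (val g) (valP f)).

Fact free_nualg_mulA : associative free_nualg_mul.
Proof. by move=> f g h; apply/val_inj/mulrA. Qed.

Fact free_nualg_mulDl : left_distributive free_nualg_mul +%R.
Proof. by move=> f g h; apply/val_inj/mulrDl. Qed.

Fact free_nualg_mulDr : right_distributive free_nualg_mul +%R.
Proof. by move=> f g h; apply/val_inj/mulrDr. Qed.

Fact free_nualg_scalerAl (c : k) (f g : free_nualg) :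
  c *: free_nualg_mul f g = free_nualg_mul (c *: f) g.
Proof. by apply/val_inj/scalerAl. Qed.

Fact free_nualg_scalerAr (c : k) (f g : free_nualg) :
  c *: free_nualg_mul f g = free_nualg_mul f (c *: g).
Proof. by apply/val_inj/malg_scalerAr. Qed.

HB.instance Definition _ := Lmodule_isNUAlgebra.Build k free_nualg
  free_nualg_mulA free_nualg_mulDl free_nualg_mulDr
  free_nualg_scalerAl free_nualg_scalerAr.

Fact no_constantU (x : X) : << fmu x >> \in no_constant.
Proof. by rewrite inE mcoeffU fmP fmU fm1. Qed.

Definition free_nualg_var (x : X) : free_nualg := FreeNUAlg (no_constantU x).

End FreeNUAlgebra.

Section IdealZ.
Context {k : fieldType} {X : choiceType}.

Local Notation "''x_' i" := (@free_nualg_var k X i)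
  (at level 8, i at level 2, format "''x_' i").

(* A predicate, because for |X| > 1 the ideal is specified through an arbitrary
   choice of two distinct variables; every such choice gives the same ideal. *)
Definition is_Z (Z : set (free_nualg k X)) : Prop :=
  (exists x y : X, x <> y /\ Z = Tideal_gen [set ('x_x * 'x_y)%NU])
  \/ (exists x : X, (forall y : X, y = x)
                    /\ Z = Tideal_gen [set ('x_x * 'x_x)%NU]).

Lemma is_Z_exists (x : X) : exists Z, is_Z Z.
Proof.
have [[y xy]|Xx] := pselect (exists y, x <> y).
  by exists (Tideal_gen [set ('x_x * 'x_y)%NU]); left; exists x, y.
exists (Tideal_gen [set ('x_x * 'x_x)%NU]); right; exists x; split=> // y.
by have [//|yx] := pselect (y = x); case: Xx; exists y => xy; apply: yx.
Qed.

End IdealZ.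

(* Main.v *)
Require Import Defs.
From mathcomp Require Import all_boot all_order all_algebra.
From mathcomp Require Import boolp classical_sets functions cardinality.
From mathcomp Require Import finmap monalg.

(** Grade the free algebra by word length. Over an infinite field a T-space [S]
    contains every homogeneous component of each of its elements [f]: the
    endomorphism scaling all variables by [c] sends [f] to the sum of the
    [c ^+ i *: f_i], and a Vandermonde argument over enough scalars [c] isolates
    each [f_i] ([subspace_coef], [Tspace_homcomp]).

    Suppose some [f] in [S] has a nonzero coefficient [a] at a variable [x]. Its
    linear component lies in [S], and the endomorphism that sends [x] to
    [a^-1 *: g] and kills the other variables maps that component to [g]. As [g]
    is arbitrary, [S] is the whole algebra. So the elements of a proper T-space
    have no linear part ([Tspace_linear_coef]): they are combinations of words of
    length at least 2.

    All these words lie in [Z]: the products of two variables do, by substituting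
    in the generator, and every longer word is a multiple of one of these
    ([is_Z_word]).

    Both halves rest on the universal property of the free algebra: any
    assignment of the variables extends to an endomorphism ([nueval_endo]). *)

Import GRing.Theory.
Local Open Scope classical_set_scope.
Local Open Scope ring_scope.

(** * Subspaces and polynomial families of vectors *)

Section Subspaces.
Set Implicit Arguments.
Unset Strict Implicit.
Context {k : fieldType} {V : lmodType k}.

Definition subspace (S : set V) : Prop :=
  S 0 /\ forall (c : k) (a b : V), S a -> S b -> S (c *: a + b).

Lemma subspace_scale (S : set V) (c : k) (a : V) :
  subspace S -> S a -> S (c *: a).
Proof. by case=> S0 Slin Sa; rewrite -[_ *: _]addr0; apply: Slin. Qed.

Lemma subspace_sum (S : set V) (I : eqType) (r : seq I) (P : pred I)
    (F : I -> V) :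
  subspace S -> (forall i, i \in r -> P i -> S (F i)) ->
  S (\sum_(i <- r | P i) F i).
Proof.
case=> S0 Slin SF; rewrite big_seq_cond; elim/big_ind: _ => //.
  by move=> a b Sa Sb; rewrite -[a]scale1r; apply: Slin.
by move=> i /andP[ir Pi]; apply: SF.
Qed.

Lemma Vandermonde_unit (n : nat) (a : 'rV[k]_n) :
  injective (a 0) -> Vandermonde n a \in unitmx.
Proof.
move=> a_inj; rewrite unitmxE det_Vandermonde unitfE prodf_seq_neq0.
apply/allP => i _ /=; rewrite prodf_seq_neq0; apply/allP => j _ /=.
apply/implyP => lt_ij; rewrite subr_eq0; apply/eqP => /a_inj eq_ij.
by rewrite eq_ij ltnn in lt_ij.
Qed.

(** Evaluating the family [v], seen as a polynomial with vector coefficients, at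
    [n] distinct nodes multiplies it by an invertible Vandermonde matrix, so each
    coefficient is a linear combination of [n] values. An infinite field has
    enough nodes whatever [n] is; over a field with [q] elements the values do
    not determine the coefficients, as [c *: v - c ^+ q *: v] always vanishes. *)
Lemma subspace_coef (S : set V) (n : nat) (v : 'I_n -> V) :
  infinite_set [set: k] -> subspace S ->
  (forall c : k, S (\sum_(i < n) c ^+ i *: v i)) -> forall i, S (v i).
Proof.
move=> kinf S_sub Sv l; have [B _ sizeB] := infinite_set_fset n kinf.
(* Any [n] distinct scalars will do as interpolation nodes. *)
pose a : 'rV[k]_n := \row_(i < n) B`_i.
have a_inj : injective (a 0).
  move=> i j; rewrite !mxE => /eqP; rewrite nth_uniq ?fset_uniq //.
  - by move=> /eqP/ord_inj.
  - exact: leq_trans (ltn_ord i) sizeB.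
  - exact: leq_trans (ltn_ord j) sizeB.
pose W := invmx (Vandermonde n a).
have invW (i : 'I_n) : \sum_(j < n) W j l * a 0 j ^+ i = (i == l)%:R.
  have <- : (Vandermonde n a *m W) i l = (i == l)%:R.
    by rewrite mulmxV ?Vandermonde_unit // mxE.
  by rewrite [RHS]mxE; apply: eq_bigr => j _; rewrite [in RHS]mxE mulrC.
have -> : v l = \sum_(j < n) W j l *: \sum_(i < n) a 0 j ^+ i *: v i.
  under eq_bigr do rewrite scaler_sumr.
  rewrite exchange_big [RHS](bigD1 l) //= [X in _ = _ + X]big1 ?addr0
    => [|i ne_il].
    by under eq_bigr do rewrite scalerA; rewrite -scaler_suml invW eqxx scale1r.
  under eq_bigr do rewrite scalerA.
  by rewrite -scaler_suml invW (negPf ne_il) scale0r.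
by apply: subspace_sum => // j _ _; apply: subspace_scale.
Qed.

End Subspaces.

(** * Products in a nonunitary algebra *)

Section NonunitaryProducts.
Set Implicit Arguments.
Unset Strict Implicit.
Context {k : fieldType} {A : nuAlgType k}.

Lemma numul0l (a : A) : (0 * a)%NU = 0.
Proof. by have := scale_numull 0 0 a; rewrite !scale0r. Qed.

Lemma numul0r (a : A) : (a * 0)%NU = 0.
Proof. by have := scale_numulr 0 a 0; rewrite !scale0r. Qed.

Lemma numul_suml (I : Type) (r : seq I) (P : pred I) (F : I -> A) (a : A) :
  ((\sum_(i <- r | P i) F i) * a)%NU = \sum_(i <- r | P i) (F i * a)%NU.
Proof.
exact: (big_morph (fun b => (b * a)%NU) (fun b c => numulDl b c a) (numul0l a)).
Qed.

Lemma numul_sumr (I : Type) (r : seq I) (P : pred I) (F : I -> A) (a : A) :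
  (a * (\sum_(i <- r | P i) F i))%NU = \sum_(i <- r | P i) (a * F i)%NU.
Proof. exact: (big_morph _ (numulDr a) (numul0r a)). Qed.

(** Without a unit the empty product has no natural value; the junk value 0 keeps
    [nuprod] total, and products only split along nonempty lists. *)
Fixpoint nuprod {X : Type} (h : X -> A) (s : seq X) : A :=
  match s with
  | [::] => 0
  | x :: s' => if s' is [::] then h x else (h x * nuprod h s')%NU
  end.

Lemma nuprod_cat (X : Type) (h : X -> A) (s t : seq X) :
  (0 < size s)%N -> (0 < size t)%N ->
  nuprod h (s ++ t) = (nuprod h s * nuprod h t)%NU.
Proof.
move=> s_gt0; case: t => // y t _; elim: s s_gt0 => // x [|x' s] IH _ //.
by rewrite -numulA -IH.
Qed.

Lemma nuprod_scale (X : Type) (c : k) (h : X -> A) (s : seq X) :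
  nuprod (fun x => c *: h x) s = c ^+ size s *: nuprod h s.
Proof.
elim: s => [|x [|y s] IH]; first by rewrite scaler0.
  by rewrite expr1.
have -> : nuprod (fun x => c *: h x) (x :: y :: s)
  = ((c *: h x) * nuprod (fun x => c *: h x) (y :: s))%NU by [].
by rewrite IH -scale_numull -scale_numulr scalerA -exprS.
Qed.

Lemma Tspace_subspace (S : set A) : Tspace S -> subspace S.
Proof. by case. Qed.

End NonunitaryProducts.

(** * The free nonunitary algebra and its universal property *)

Section FreeAlgebra.
Set Implicit Arguments.
Unset Strict Implicit.
Context {k : fieldType} {X : choiceType}.
Implicit Types (f g : free_nualg k X) (w : {fmonom X}).

Definition word (s : seq X) : free_nualg k X := nuprod (@free_nualg_var k X) s.

Lemma val_word (s : seq X) :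
  (0 < size s)%N -> val (word s) = << FMonom s >> :> {malg k[{fmonom X}]}.
Proof.
elim: s => // x [|y s] IH _; first by rewrite /= fmuE.
have -> : word (x :: y :: s) = (free_nualg_var k x * word (y :: s))%NU by [].
rewrite -[val _]/(val (free_nualg_var k x) * val (word (y :: s))) IH //.
rewrite malgME !msuppU oner_eq0 !big_seq_fset1 !mcoeffUU mulr1 /=.
by congr << _ >>; apply/eqP; rewrite fmP fmM fmU.
Qed.

Lemma msupp_size_gt0 f w : w \in msupp (val f) -> (0 < size w)%N.
Proof.
rewrite -mcoeff_neq0; apply: contraR; rewrite -leqNgt leqn0 => w0.
have -> : w = mone by apply: fdeg_eq0I; apply/eqP.
by have := valP f; rewrite inE.
Qed.

(** The words span. The sum runs over nonempty words, since the empty one is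
    never in the support; so the junk value [word [::] = 0] does not occur. *)
Lemma free_nualgE f : f = \sum_(w <- msupp (val f)) (val f)@_w *: word w.
Proof.
apply: val_inj; rewrite raddf_sum /= {1}[X in X = _]monalgE.
apply: eq_big_seq => w /msupp_size_gt0 w_gt0.
rewrite -[RHS]/(_ *: val (word w)) val_word // fmK.
by apply/malgP => u; rewrite mcoeffZ !mcoeffU mulrnAr mulr1.
Qed.

Section Eval.
Context {A : nuAlgType k} (h : X -> A).

(** The map that the universal property associates with the assignment [h]. *)
Definition nueval f : A := \sum_(w <- msupp (val f)) (val f)@_w *: nuprod h w.

Lemma nuevalEw (d : {fset {fmonom X}}) f : (msupp (val f) `<=` d)%fset ->
  nueval f = \sum_(w <- d) (val f)@_w *: nuprod h w.
Proof.
move=> le; rewrite /nueval (big_fset_incl _ le) //= => w _ /mcoeff_outdom ->.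
by rewrite scale0r.
Qed.

Lemma nueval_linear : linear nueval.
Proof.
move=> c f g.
pose d := (msupp (val f) `|` msupp (val g) `|` msupp (val (c *: f + g)%R))%fset.
rewrite !(nuevalEw (d := d)); first last.
- by rewrite /d fsubsetUr.
- by rewrite /d -fsetUA fsubsetUl.
- by rewrite /d -fsetUA fsetUCA fsubsetUl.
rewrite scaler_sumr -big_split; apply: eq_bigr => w _ /=.
by rewrite mcoeffD mcoeffZ scalerDl scalerA.
Qed.

Lemma nueval_sum (I : Type) (r : seq I) (P : pred I) (c : I -> k)
    (F : I -> free_nualg k X) :
  nueval (\sum_(i <- r | P i) c i *: F i)
  = \sum_(i <- r | P i) c i *: nueval (F i).
Proof.
have nueval0 : nueval 0 = 0 by rewrite /nueval msupp0 big_seq_fset0.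
elim: r => [|i r IH]; first by rewrite !big_nil.
by rewrite !big_cons; case: (P i) => //; rewrite nueval_linear IH.
Qed.

Lemma nueval_word (s : seq X) : nueval (word s) = nuprod h s.
Proof.
case: s => [|x s]; first by rewrite /nueval msupp0 big_seq_fset0.
rewrite /nueval val_word // msuppU oner_eq0 big_seq_fset1.
by rewrite mcoeffUU scale1r.
Qed.

(** Expanding both factors over words reduces the claim to two words, where it is
    the splitting of a product along a concatenation. *)
Lemma nueval_mul : {morph nueval : f g / (f * g)%NU}.
Proof.
move=> f g; rewrite {1}[f]free_nualgE {1}[g]free_nualgE.
rewrite /nueval !numul_suml -[LHS]/(nueval _).
(* The trivial coefficient 1 puts the outer sum in the form that [nueval_sum]
   expects. *)
transitivity (nueval (\sum_(u <- msupp (val f)) 1 *: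
   \sum_(v <- msupp (val g)) ((val f)@_u * (val g)@_v) *: word (u ++ v))).
  congr nueval; apply: eq_big_seq => u /msupp_size_gt0 u0.
  rewrite numul_sumr scale1r; apply: eq_big_seq => v /msupp_size_gt0 v0.
  by rewrite -scale_numull -scale_numulr scalerA /word nuprod_cat.
rewrite nueval_sum; apply: eq_big_seq => u /msupp_size_gt0 u0.
rewrite scale1r nueval_sum numul_sumr; apply: eq_big_seq => v /msupp_size_gt0 v0.
by rewrite -scale_numull -scale_numulr scalerA nueval_word nuprod_cat.
Qed.

End Eval.

Lemma nueval_endo (h : X -> free_nualg k X) : nualg_endo (nueval h).
Proof. by split; [exact: nueval_linear | exact: nueval_mul]. Qed.

(** * Homogeneous components of elements of a T-space *)

Definition homcomp (d : nat) f : free_nualg k X :=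
  \sum_(w <- msupp (val f) | size w == d) (val f)@_w *: word w.

(** Substituting [c *: x] for every variable [x] multiplies a word of length [i]
    by [c ^+ i], so the values of this substitution at [f] are polynomial in [c]
    with the homogeneous components of [f] as coefficients. *)
Lemma Tspace_homcomp (S : set (free_nualg k X)) f (d : nat) :
  infinite_set [set: k] -> Tspace S -> S f -> S (homcomp d f).
Proof.
move=> kinf ST Sf.
(* A bound above [d] and every length of a word of [f]. *)
pose n := (d + \max_(w <- msupp (val f)) size w).+1.
have d_lt : (d < n)%N by rewrite ltnS leq_addr.
pose v (i : 'I_n) := homcomp i f.
apply: (subspace_coef (v := v) kinf (Tspace_subspace ST) _ (Ordinal d_lt)) => c.
pose h (x : X) := c *: free_nualg_var k x.
case: (ST) => _ _ /(_ _ (nueval_endo h) _ Sf).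
congr S; rewrite /nueval /v /homcomp.
under [RHS]eq_bigr do rewrite scaler_sumr.
under [RHS]eq_bigr do rewrite big_mkcond.
rewrite exchange_big; apply: eq_big_seq => w wf /=.
have w_lt : (size w < n)%N.
  rewrite ltnS; apply: leq_trans (leq_addl _ _).
  by rewrite (big_rem w) //= leq_maxl.
rewrite nuprod_scale (bigD1 (Ordinal w_lt)) //= eqxx big1 => [|i ne_i].
  by rewrite addr0 !scalerA mulrC.
by rewrite ifN // eq_sym; apply: contra ne_i => /eqP ?; apply/eqP/val_inj.
Qed.

Lemma nueval_homcomp1 (h : X -> free_nualg k X) f (x : X) :
  (forall y, y <> x -> h y = 0) ->
  nueval h (homcomp 1 f) = (val f)@_(fmu x) *: h x.
Proof.
move=> h0; rewrite nueval_sum.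
have -> : (val f)@_(fmu x) *: h x
    = \sum_(w <- msupp (val f) | w == fmu x) (val f)@_w *: h x.
  have [xf|xf] := boolP (fmu x \in msupp (val f)).
    by rewrite -big_filter filter_pred1_uniq ?fset_uniq // big_seq1.
  by rewrite mcoeff_outdom // scale0r big1 // => w /eqP ->;
    rewrite mcoeff_outdom // scale0r.
rewrite big_mkcond [RHS]big_mkcond; apply: eq_bigr => -[[|y [|z s]]] _ //=;
  rewrite fmP fmU //; last by case: eqP.
rewrite nueval_word /=; case: eqP => [[->]//|yx].
by rewrite h0 ?scaler0 // => eq_yx; apply: yx; rewrite eq_yx.
Qed.

(** A nonzero linear coefficient generates everything: the linear component of
    [f] lies in [S] and can be mapped onto an arbitrary element by an
    endomorphism supported on the single variable [x]. *)
Lemma Tspace_linear_coef (S : set (free_nualg k X)) f (x : X) :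
  infinite_set [set: k] -> Tspace S -> S <> setT -> S f ->
  (val f)@_(fmu x) = 0.
Proof.
move=> kinf ST S_proper Sf; apply/eqP/negPn/negP => fx0; apply: S_proper.
apply/seteqP; split=> // g _.
pose h y := if y == x then ((val f)@_(fmu x))^-1 *: g else 0.
case: (ST) => _ _ /(_ _ (nueval_endo h) _ (Tspace_homcomp 1 kinf ST Sf)).
rewrite (@nueval_homcomp1 h f x) => [|y /eqP/negPf yx]; last by rewrite /h yx.
by rewrite /h eqxx scalerA mulfV // scale1r.
Qed.

(** * Words of length at least 2 lie in Z *)

Lemma is_Z_Tideal (Z : set (free_nualg k X)) : is_Z Z -> Tideal Z.
Proof.
by case=> [[x [y [_ ->]]]|[x [_ ->]]]; exact: Tideal_gen_Tideal.
Qed.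

(** With several variables, the generator is a product of two distinct variables,
    which can be sent independently to [a] and [b]; with one variable there is
    only its square to consider. *)
Lemma is_Z_mul_var (Z : set (free_nualg k X)) (a b : X) :
  is_Z Z -> Z (free_nualg_var k a * free_nualg_var k b)%NU.
Proof.
move=> HZ; have [[_ _ Zendo] _] := is_Z_Tideal HZ.
case: HZ => [[x [y [xy eqZ]]]|[x [Xx eqZ]]]; last first.
  by rewrite (Xx a) (Xx b) eqZ => I [_]; apply.
pose h z := if z == x then free_nualg_var k a else free_nualg_var k b.
have Zxy : Z (free_nualg_var k x * free_nualg_var k y)%NU.
  by rewrite eqZ => I [_]; apply.
have := Zendo _ (nueval_endo h) _ Zxy.
have eval_var z : nueval h (free_nualg_var k z) = h z := nueval_word h [:: z].
rewrite nueval_mul !eval_var /h eqxx.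
by have /negPf -> : y != x by apply/eqP => yx; apply: xy.
Qed.

Lemma is_Z_word (Z : set (free_nualg k X)) (s : seq X) :
  is_Z Z -> (1 < size s)%N -> Z (word s).
Proof.
move=> HZ; have [_ Zideal] := is_Z_Tideal HZ.
case: s => // a [//|b s] _; case: s => [|c s]; first exact: is_Z_mul_var.
rewrite /word -[a :: _]/([:: a; b] ++ c :: s) nuprod_cat //.
by apply: (Zideal _ _ _).2; exact: is_Z_mul_var.
Qed.

End FreeAlgebra.

Theorem proposition1p3 (X : choiceType) (k : fieldType)
    (X_nonempty : inhabited X) (k_infinite : infinite_set [set: k])
    (Z : set (free_nualg k X)) (Z_def : is_Z Z)
    (S : set (free_nualg k X)) (S_Tspace : Tspace S)
    (S_proper : S <> [set: free_nualg k X]) :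
  S `<=` Z.
Proof.
have [Z_Tspace _] := is_Z_Tideal Z_def.
move=> f Sf; rewrite [f]free_nualgE.
apply: subspace_sum => [|w wf _]; first exact: Tspace_subspace.
have [w_gt1|] := ltnP 1 (size w).
  by apply: subspace_scale; [exact: Tspace_subspace | exact: is_Z_word].
have := msupp_size_gt0 wf; case: w wf => -[|x [|y s]] //= wf _ _.
rewrite -fmuE (Tspace_linear_coef x k_infinite S_Tspace) // scale0r.
by case: Z_Tspace.
Qed.
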